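(* Let $n\ge 2$ be an integer and let $M_1,\dots,M_{n-1}\in\mathbb{R}^n$. Then $$\times\left(\overleftarrow{M_1},\overleftarrow{M_2},\dots,\overleftarrow{M_{n-1}}\right)=\begin{cases}(-1)^{\frac{3n}{2}}\;\overleftarrow{\times(M_1,M_2,\dots,M_{n-1})}, & n \text{ even},\\[4pt] (-1)^{\frac{3n+1}{2}}\;\overleftarrow{\times(M_1,M_2,\dots,M_{n-1})}, & n\text{ odd}.\end{cases}$$
   Context: The reversing of a vector $v=(v_1,v_2,\dots,v_n)\in\mathbb{R}^n$ is $\overleftarrow{v}=(v_n,v_{n-1},\dots,v_1)$, i.e. its $j$-th entry is $v_{n-j+1}$. The generalized vector product $\times:(\mathbb{R}^n)^{n-1}\to\mathbb{R}^n$ is $$\times(M_1,\dots,M_{n-1})=\sum_{k=1}^n(-1)^{1+k}\det\left(M^{(k)}\right)e_k,$$ where $e_k$ is the $k$-th standard basis vector of $\mathbb{R}^n$ and $M^{(k)}$ is the $(n-1)\times(n-1)$ matrix obtained by deleting the $k$-th column of the $(n-1)\times n$ matrix $M$ with rows $M_1,\dots,M_{n-1}$. *)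

(* Defs.v *)
From HB Require Import structures.
From mathcomp Require Import all_boot all_order all_algebra.
From mathcomp Require Import reals.

Set Implicit Arguments.
Unset Strict Implicit.
Unset Printing Implicit Defensive.

Import GRing.Theory.
Local Open Scope ring_scope.

(* Indices are 0-based: [rev_ord j = n - j.+1], so the entry number [j.+1] of
   [rev_vec v] is the entry number [n - (j.+1) + 1] of [v]. *)
Definition rev_vec (R : realType) (n : nat) (v : 'rV[R]_n) : 'rV[R]_n :=
  \row_(j < n) v 0 (rev_ord j).

(* The 1-based column number is [k.+1], so the usual sign (-1)^(1 + column)
   reads (-1) ^+ (1 + k.+1) here. *)
Definition vector_product (R : realType) (n : nat)
    (M : 'I_n.-1 -> 'rV[R]_n) : 'rV[R]_n :=
  \sum_(k < n)
    ((-1) ^+ (1 + k.+1) * \det (col' k (\matrix_(i < n.-1) M i)))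
      *: delta_mx 0 k.

(* Main.v *)
Require Import Defs.
From HB Require Import structures.
From mathcomp Require Import all_boot all_order all_algebra.
From mathcomp Require Import fingroup perm.
From mathcomp Require Import reals.
From mathcomp Require Import zify.

(** Deleting column [k] from the matrix with reversed rows gives the matrix [M]
    without its column [rev_ord k], with its [n.-1] remaining columns reversed
    ([col'_rev]).  Reversing [m] columns multiplies a determinant by the sign
    of the order-reversing permutation, which has one inversion for each pair
    of indices, hence the sign [(-1) ^+ 'C(m, 2)] ([det_rev_cols]).  The
    alternating signs attached to the columns [k] and [rev_ord k] differ by
    [(-1) ^+ n.+1].  So the two sides differ by the constant sign
    [(-1) ^+ ('C(n.-1, 2) + n.+1)], and it remains to compute the parity of
    this exponent in terms of the parity of [n] ([odd_bin2_addS]). *)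

Set Implicit Arguments.
Unset Strict Implicit.
Unset Printing Implicit Defensive.

Import GRing.Theory.
Local Open Scope ring_scope.

(** The reversal of [0, .., n] sends [0] to [n] and reverses the remaining
    indices; peeling off this pair adds the [n] inversions that involve [0]. *)
Lemma odd_rev_perm n : perm (@rev_ord_inj n) = odd 'C(n, 2) :> bool.
Proof.
elim: n => [|n IHn].
  suff -> : perm (@rev_ord_inj 0) = 1%g by rewrite odd_perm1.
  by apply/permP; case.
suff -> : perm (@rev_ord_inj n.+1) = lift_perm ord0 ord_max (perm (@rev_ord_inj n)).
  by rewrite odd_lift_perm IHn binS bin1 oddD /= addbC.
apply/permP => i; rewrite permE.
case: (unliftP ord0 i) => [j|] ->; last first.
  by rewrite lift_perm_id; apply: val_inj; rewrite /= subn1.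
rewrite lift_perm_lift permE; apply: val_inj => /=.
by rewrite /bump; have := ltn_ord j; lia.
Qed.

Lemma det_rev_cols (R : comPzRingType) m (A : 'M[R]_m) :
  \det (\matrix_(i, j) A i (rev_ord j)) = (-1) ^+ 'C(m, 2) * \det A.
Proof.
have -> : \matrix_(i, j) A i (rev_ord j) = col_perm (perm (@rev_ord_inj m)) A.
  by apply/matrixP => i j; rewrite !mxE permE.
by rewrite col_permE det_mulmx det_perm odd_permV odd_rev_perm signr_odd mulrC.
Qed.

Lemma rev_lift n (k : 'I_n) (j : 'I_n.-1) :
  rev_ord (lift k j) = lift (rev_ord k) (rev_ord j).
Proof.
apply: val_inj => /=; rewrite /bump.
by have := ltn_ord k; have := ltn_ord j; lia.
Qed.

Lemma col'_rev (R : Type) m n (A : 'M[R]_(m, n)) (k : 'I_n) :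
  col' k (\matrix_(i, j) A i (rev_ord j)) =
  \matrix_(i, j) col' (rev_ord k) A i (rev_ord j).
Proof. by apply/matrixP => i j; rewrite !mxE rev_lift. Qed.

Lemma vector_productE (R : realType) n (M : 'I_n.-1 -> 'rV[R]_n) k :
  vector_product M 0 k = (-1) ^+ k * \det (col' k (\matrix_(i < n.-1) M i)).
Proof.
rewrite summxE (bigD1 k) //= big1 => [|i neq_ik].
  by rewrite !mxE !eqxx mulr1 addr0 addnS !exprS !mulN1r opprK.
by rewrite !mxE eqxx eq_sym (negPf neq_ik) mulr0.
Qed.

Lemma vector_product_rev (R : realType) n (M : 'I_n.-1 -> 'rV[R]_n) :
  vector_product (fun i => rev_vec (M i)) =
  (-1) ^+ ('C(n.-1, 2) + n.+1) *: rev_vec (vector_product M).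
Proof.
apply/rowP => k; rewrite !mxE !vector_productE.
have -> : \matrix_(i < n.-1) rev_vec (M i) =
          \matrix_(i, j) (\matrix_(i < n.-1) M i) i (rev_ord j).
  by apply/matrixP => i j; rewrite !mxE.
rewrite col'_rev det_rev_cols !mulrA -!exprD; congr (_ * _).
rewrite -signr_odd -[RHS]signr_odd; congr (_ ^+ nat_of_bool _).
by have /= := ltn_ord k; lia.
Qed.

(** Writing [n] as [2 * k] or [2 * k + 1], ['C(n.-1, 2)] is [(2 * k - 1) * (k - 1)]
    or [k * (2 * k - 1)], so that both sides have the parity of [k]. *)
Lemma odd_bin2_addS n : (0 < n)%N ->
  odd ('C(n.-1, 2) + n.+1) =
  odd (if odd n then (3 * n + 1) %/ 2 else (3 * n) %/ 2)%N.
Proof.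
rewrite bin2 => n_gt0.
have [k [b def_n]] : exists k : nat, exists b : bool, n = (b + k.*2)%N.
  by exists n./2, (odd n); rewrite odd_double_half.
case: b def_n => def_n; rewrite def_n [odd (_ + k.*2)%N]oddD odd_double /=.
  case: k def_n => [|k] _ //.
  have -> : (k.+1.*2 * k.+1.*2.-1)%N = (k.+1 * k.*2.+1).*2 by lia.
  by rewrite doubleK oddD oddM; lia.
case: k def_n => [|k] def_n; first by rewrite def_n in n_gt0.
have -> : (k.+1.*2.-1 * k.+1.*2.-1.-1)%N = (k.*2.+1 * k).*2 by lia.
by rewrite doubleK oddD oddM; lia.
Qed.

Theorem proposition8 (R : realType) (n : nat) (hn : (2 <= n)%N)
    (M : 'I_n.-1 -> 'rV[R]_n) :
  vector_product (fun i : 'I_n.-1 => rev_vec (M i)) =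
    if odd n
    then (-1) ^+ ((3 * n + 1) %/ 2)%N *: rev_vec (vector_product M)
    else (-1) ^+ ((3 * n) %/ 2)%N *: rev_vec (vector_product M).
Proof.
rewrite vector_product_rev -signr_odd odd_bin2_addS ?signr_odd; last exact: ltnW.
by case: (odd n).
Qed.
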